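(* Let $X$ be a real reflexive Banach space with dual $Y$, let $\varepsilon > 0$, let $\phi\in\Gamma_0(X)$, let $M = \mathrm{Graph}(\partial\phi) = \{(x,y)\in X\times Y : y\in\partial\phi(x)\}$ (a maximal cyclically monotone set), and let $A\subset X\times Y$ be defined by $A = \{0\}\times\bar{B}_Y(\varepsilon)$, where $\bar{B}_Y(\varepsilon) = \{y \in Y : \|y\|\leq\varepsilon\}$. Then $M$ admits the blurring $A$ if and only if for every $y\in Y$ the set $$\bigcup_{\bar{y}\in Y,\ \|\bar{y}-y\|\leq\varepsilon}\partial\phi^{*}(\bar{y})$$ is convex.
   Context: $X$ is a real reflexive Banach space, $Y = X^*$ its dual, $\langle x,y\rangle = y(x)$, and $\|\cdot\|$ denotes both the norm of $X$ and the dual norm of $Y$. By reflexivity, the dual of $Y$ is identified with $X$. $\Gamma_0(X)$ is the set of convex lower semicontinuous functions $\psi : X \to \mathbb{R}\cup\{+\infty\}$ which are finite at some point. The subdifferential is $\partial\psi(x) = \{u \in Y : \langle z - x, u\rangle \leq \psi(z) - \psi(x)\ \forall z \in X\}$ (empty if $\psi(x)=+\infty$); for functions on $Y$ the subdifferential is a subset of $X$, defined analogously. The Fenchel conjugate of $\phi$ is $\phi^*(y) = \sup_{x\in X}(\langle x,y\rangle - \phi(x))$. A set $M\subset X\times Y$ is a BB-graph (bi-convex and bi-closed) if for any $x\in X$ and $y\in Y$ the sections $M(x) = \{y\in Y : (x,y)\in M\}$ and $M^*(y) = \{x\in X : (x,y)\in M\}$ are convex and closed (the empty set is allowed as a section).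 Given BB-graphs $M, A\subset X\times Y$ with $(0,0)\in A$, one says that $M$ admits the blurring $A$ if the set $M + A = \{(x'+x'', y'+y'') : (x',y')\in M,\ (x'',y'')\in A\}$ is a BB-graph. *)

(* Defs.v *)
From HB Require Import structures.
From mathcomp Require Import all_boot all_order all_algebra.
From mathcomp Require Import all_classical all_reals.
From mathcomp Require Import ereal topology normedtype convex.

Set Implicit Arguments.
Unset Strict Implicit.
Unset Printing Implicit Defensive.

Import Order.TTheory GRing.Theory Num.Theory.
Import numFieldNormedType.Exports.

Local Open Scope classical_set_scope.
Local Open Scope ring_scope.

Section dual_submodule.
Context {R : realType} {X : normedModType R}.

Definition clinear : {pred X -> R^o} :=
  [pred f : X -> R^o | `[< linear f /\ continuous f >]].

Lemma clinear_submod_closed : submod_closed clinear.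
Proof.
split=> [|a f g]; rewrite !inE.
  by split=> [k u v|]; [rewrite /= scaler0 addr0|exact: cst_continuous].
move=> [lf cf] [lg cg]; split=> [k u v|x].
  by rewrite !fctE lf lg !scalerDr !scalerA [a * k]mulrC addrACA.
by apply: cvgD; [apply: cvgZl_tmp; exact: cf|exact: cg].
Qed.

HB.instance Definition _ :=
  GRing.isSubmodClosed.Build R (X -> R^o) clinear clinear_submod_closed.

End dual_submodule.

Record dual (R : realType) (X : normedModType R) := Dual {
  dual_fun :> X -> R^o ;
  dual_funP : dual_fun \in clinear
}.

Section dual_lmodType.
Context {R : realType} {X : normedModType R}.

HB.instance Definition _ := [isSub of dual X for @dual_fun R X].
HB.instance Definition _ := [Choice of dual X by <:].
HB.instance Definition _ := [SubChoice_isSubLmodule of dual X by <:].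

Lemma dual_linear (f : dual X) : linear f.
Proof. by have := dual_funP f; rewrite inE => -[]. Qed.

Lemma dual_continuous (f : dual X) : continuous f.
Proof. by have := dual_funP f; rewrite inE => -[]. Qed.

HB.instance Definition _ (f : dual X) :=
  GRing.isLinear.Build R X R^o *:%R (f : X -> R^o) (dual_linear f).

Lemma dual_addE (f g : dual X) x : (f + g) x = f x + g x. Proof. by []. Qed.

Lemma dual_scaleE a (f : dual X) x : (a *: f) x = a * f x. Proof. by []. Qed.

Lemma dualP (f g : dual X) : (forall x, f x = g x) -> f = g.
Proof. by move=> fg; apply: val_inj; apply/funext. Qed.

End dual_lmodType.

Section dual_norm.
Context {R : realType} {X : normedModType R}.
Implicit Types f g : dual X.

Definition dual_norm f : R := sup [set `|f x| | x in [set x : X | `|x| <= 1]].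

Let has_sup_dual f : has_sup [set `|f x| | x in [set x : X | `|x| <= 1]].
Proof.
split; first by exists `|f 0|; exists 0 => //=; rewrite normr0.
have /bounded_funP/(_ 1)[M fM] :=
  (linear_bounded_continuous (f : {linear X -> R^o})).2 (@dual_continuous _ _ f).
by exists M => _ [x x1 <-]; exact: fM.
Qed.

Lemma dual_norm_ub f x : `|x| <= 1 -> `|f x| <= dual_norm f.
Proof. by move=> x1; apply: (sup_upper_bound (has_sup_dual f)); exists x. Qed.

Let dual_norm_le f M :
  (forall x, `|x| <= 1 -> `|f x| <= M) -> dual_norm f <= M.
Proof.
move=> fM; apply: ge_sup; first by case: (has_sup_dual f).
by move=> _ [x x1 <-]; exact: fM.
Qed.

Lemma dual_norm_opP f x : `|f x| <= dual_norm f * `|x|.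
Proof.
have [->|x0] := eqVneq x 0; first by rewrite linear0 !normr0 mulr0.
have nx0 : 0 < `|x| by rewrite normr_gt0.
rewrite -ler_pdivrMr//; have := @dual_norm_ub f (`|x|^-1 *: x).
rewrite normrZ normfV normr_id mulVf ?gt_eqF// => /(_ (lexx _)).
by rewrite linearZ /= normrM normfV normr_id mulrC.
Qed.

Let dual_normD f g : dual_norm (f + g) <= dual_norm f + dual_norm g.
Proof.
apply: dual_norm_le => x x1; rewrite dual_addE.
by rewrite (le_trans (ler_normD _ _))// lerD// dual_norm_ub.
Qed.

Let dual_normZ_le a f : dual_norm (a *: f) <= `|a| * dual_norm f.
Proof.
apply: dual_norm_le => x x1; rewrite dual_scaleE normrM.
by rewrite ler_wpM2l// dual_norm_ub.
Qed.

Let dual_normZ a f : dual_norm (a *: f) = `|a| * dual_norm f.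
Proof.
apply/eqP; rewrite eq_le dual_normZ_le /=.
have [->|a0] := eqVneq a 0.
  rewrite normr0 mul0r (le_trans (normr_ge0 ((0 *: f) 0)))//.
  by rewrite dual_norm_ub// normr0.
rewrite -ler_pdivlMl ?normr_gt0// -normfV.
by apply: le_trans (dual_normZ_le _ _); rewrite scalerA mulVf// scale1r.
Qed.

Let dual_norm0_eq0 f : dual_norm f = 0 -> f = 0.
Proof.
move=> f0; apply: dualP => x; apply/eqP; rewrite -normr_le0.
by rewrite (le_trans (dual_norm_opP f x))// f0 mul0r.
Qed.

HB.instance Definition _ :=
  @Lmodule_isNormed.Build R (dual X) dual_norm dual_normD dual_normZ
    dual_norm0_eq0.

End dual_norm.

Definition pairing {R : realType} {X : normedModType R} (x : X) (y : dual X)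
  : R := y x.

Section reflexive.
Context {R : realType} {X : normedModType R}.

Let eval_clinear (x : X) :
  ((fun y : dual X => pairing x y) : dual X -> R^o) \in clinear.
Proof.
rewrite inE.
have lx : linear ((fun y : dual X => pairing x y) : dual X -> R^o) by [].
split=> //.
pose e : {linear dual X -> R^o} :=
  HB.pack ((fun y : dual X => pairing x y) : dual X -> R^o)
    (GRing.isLinear.Build _ _ _ _ _ lx).
apply: (bounded_linear_continuous (f := e)).
apply/bounded_funP => r; exists (r * `|x|) => y yr /=.
by rewrite (le_trans (dual_norm_opP y x))// ler_wpM2r.
Qed.

Definition bidual_embedding (x : X) : dual (dual X) := Dual (eval_clinear x).

End reflexive.

Definition reflexive_space (R : realType) (X : normedModType R) :=
  forall F : dual (dual X), exists x : X, bidual_embedding x = F.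

Section convex_analysis.
Context {R : realType} {X : normedModType R}.
Local Notation Y := (dual X).
Local Open Scope ereal_scope.

(* With [0 * +oo = 0], the end points [t = 0] and [t = 1] are harmless for
   functions that avoid [-oo]. *)
Definition econvex_function (f : X -> \bar R) :=
  forall (t : R) (x z : X), (0 <= t <= 1)%R ->
    f (t *: x + (1 - t) *: z)%R <= t%:E * f x + (1 - t)%:E * f z.

Definition Gamma0 (f : X -> \bar R) :=
  [/\ forall x, f x != -oo,
      exists x, f x \is a fin_num,
      econvex_function f &
      lower_semicontinuous f].

Definition subdifferential (f : X -> \bar R) (x : X) : set Y :=
  [set u | f x != +oo /\ forall z : X, (pairing (z - x)%R u)%:E <= f z - f x].

(* For functions on the dual of a reflexive space, subgradients are taken in
   the space itself, identified with the bidual. *)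
Definition subdifferential_dual (g : Y -> \bar R) (y : Y) : set X :=
  [set x | g y != +oo /\ forall v : Y, (pairing x (v - y)%R)%:E <= g v - g y].

Definition fenchel_conjugate (f : X -> \bar R) (y : Y) : \bar R :=
  ereal_sup [set (pairing x y)%:E - f x | x in [set: X]].

Definition subdifferential_graph (f : X -> \bar R) : set (X * Y) :=
  [set p | subdifferential f p.1 p.2].

End convex_analysis.

Section BB_graph.
Context {R : realType} {X : normedModType R}.
Local Notation Y := (dual X).

Definition BB_graph (M : set (X * Y)) :=
  (forall x : X, convex_set (xsection M x : set (convex_lmodType Y)) /\
                 closed (xsection M x)) /\
  (forall y : Y, convex_set (ysection M y : set (convex_lmodType X)) /\
                 closed (ysection M y)).

Definition Minkowski_sum (M A : set (X * Y)) : set (X * Y) :=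
  [set p + q | p in M & q in A].

Definition admits_blurring (M A : set (X * Y)) :=
  [/\ BB_graph M, BB_graph A, A (0, 0) & BB_graph (Minkowski_sum M A)].

End BB_graph.

(* Main.v *)
Require Import Defs.
From HB Require Import structures.
From mathcomp Require Import all_boot all_order all_algebra.
From mathcomp Require Import all_classical all_reals.
From mathcomp Require Import ereal topology normedtype convex.
From mathcomp Require Import ring lra.

Import Order.TTheory GRing.Theory Num.Theory.
Import numFieldNormedType.Exports.

Local Open Scope classical_set_scope.
Local Open Scope ring_scope.

(** Write [A] for the vertical ball [{0} x B(eps)] and [N] for the sum of the
subdifferential graph of [phi] and [A]; thus [(x, y)] is in [N] when [y] lies
within [eps] of a subgradient of [phi] at [x] ([Minkowski_sum_ball]). Being a
BB-graph is a condition on sections, and all parts of it but one hold for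
every [phi] and [eps].

- [N] is closed in the product for the norm topologies ([enlargement_closed]),
hence so are its sections. The reason is the weak-* compactness of dual balls:
if [(x_i, y_i)] in [N] converges to [(x, y)], the nearby subgradients [u_i] are
bounded, so along an ultrafilter they converge pointwise to some [g], which
stays within [eps] of [y]; lower semicontinuity lets the subgradient inequality
pass to the limit.

- The section of [N] at [x] is a convex set of subgradients plus a ball, hence
convex ([convex_xsection_enlargement]).

- The graph itself is the case [eps = 0] of [N], and its sections at [y] are
the minimizers of the convex function [phi - y], hence convex.

What remains is the convexity of the sections of [N] at each [y]. Such a section
consists of the points having a subgradient within [eps] of [y]. Because [y] is
a subgradient of [phi] at [x] exactly when [x] is one of the conjugate of [phi]
at [y] ([fenchel_young]), this section is the union in the theorem.

The difficult half of [fenchel_young] is the Fenchel-Moreau duality. It relies on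
a Hahn-Banach theorem for convex functions ([hahn_banach_convex]), obtained from
Zorn's lemma: a minimal convex function with nonnegative value at the origin is
linear. Applied to an inf-convolution with a multiple of the norm, this yields
continuous affine minorants ([dual_minorant_convex_set]). *)

(** * A Hahn-Banach theorem for convex functions *)

Section hahn_banach.
Context {R : realType} {V : lmodType R}.
Implicit Types (p q : V -> R) (u v w : V).

Definition convex_fun q := forall (t : R) u v, 0 <= t <= 1 ->
  q (t *: u + (1 - t) *: v) <= t * q u + (1 - t) * q v.

Definition convex_minorant p q :=
  [/\ convex_fun q, 0 <= q 0 & forall u, q u <= p u].

Definition minimal_convex q :=
  [/\ convex_fun q, 0 <= q 0 &
    forall q', convex_minorant q q' -> forall u, q' u = q u].

(** Each step exhibits a competitor below [q] and lets minimality force equality: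
subtracting [q 0] gives [q 0 = 0]; rescaling, [u |-> q (l u) / l] with [l] in
[]0, 1]], gives positive homogeneity, whence subadditivity; then the translate
[u |-> q (u + w) - q w], which subadditivity places below [q], gives additivity. *)
Lemma minimal_convex_linear q : minimal_convex q -> linear (q : V -> R^o).
Proof.
move=> [cq q0 minq].
have qz : q 0 = 0.
  have /minq/(_ 0) : convex_minorant q (fun u => q u - q 0).
    split=> [t u v t01||u]; [|by rewrite subrr|by rewrite gerBl].
    by have := cq t u v t01; lra.
  by rewrite subrr.
have homle1 (l : R) u : 0 < l -> l <= 1 -> q (l *: u) = l * q u.
  move=> l0 l1.
  have /minq/(_ u) <- : convex_minorant q (fun u => l^-1 * q (l *: u)).
    split=> [t v w t01||v].
    - rewrite scalerDr !scalerA ![l * _]mulrC -!scalerA.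
      rewrite [_ * (l^-1 * _)]mulrCA [(1 - t) * (l^-1 * _)]mulrCA -mulrDr.
      by rewrite ler_pM2l ?invr_gt0//; exact: cq.
    - by rewrite scaler0 qz mulr0.
    - rewrite ler_pdivrMl//; have := cq l v 0.
      by rewrite scaler0 qz addr0 mulr0 addr0; apply; rewrite l1 ltW.
  by rewrite mulrA mulfV ?mul1r// gt_eqF.
have hom (l : R) u : 0 < l -> q (l *: u) = l * q u.
  move=> l0; have [l1|l1] := leP l 1; first exact: homle1.
  have := homle1 l^-1 (l *: u).
  rewrite scalerA mulVf ?gt_eqF// scale1r invr_gt0 invf_le1// ltW// => -> //.
  by rewrite mulrA mulfV ?mul1r// gt_eqF.
have subadd u v : q (u + v) <= q u + q v.
  have := cq 2^-1 u v; rewrite (_ : 1 - 2^-1 = 2^-1); last by lra.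
  rewrite -scalerDr hom// -mulrDr ler_pM2l//; apply.
  by lra.
have add u w : q (u + w) = q u + q w.
  have /minq/(_ u) <- : convex_minorant q (fun u => q (u + w) - q w).
    split=> [t v z t01||v]; last by rewrite lerBlDr.
      have := cq t (v + w) (z + w) t01.
      rewrite !scalerDr addrACA -scalerDl subrKC scale1r.
      by lra.
    by rewrite add0r subrr.
  by rewrite subrK.
have opp u : q (- u) = - q u.
  by apply/eqP; rewrite -addr_eq0 -add addNr qz.
move=> a u v; rewrite add; congr (_ + _) => /=.
have [a0|a0|->] := ltgtP a 0; last by rewrite !scale0r qz.
- by rewrite -[a]opprK scaleNr opp hom ?oppr_gt0// scaleNr.
- by rewrite hom.
Qed.

(** The infimum is finite because convexity and [0 <= q 0] give
[- p (- u) <= q u] for every minorant [q]. It is convex because, in a chain, one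
function can be chosen nearly optimal at two points at once. *)
Lemma chain_inf_minorant p (A : set (V -> R)) :
  A !=set0 -> A `<=` convex_minorant p ->
  (forall q q', A q -> A q' ->
    (forall u, q u <= q' u) \/ (forall u, q' u <= q u)) ->
  let m u := inf [set q u | q in A] in
  convex_minorant p m /\ forall q, A q -> forall u, m u <= q u.
Proof.
move=> [q0 Aq0] Ap chA m.
have lb u : has_inf [set q u | q in A].
  split; first by exists (q0 u), q0.
  exists (- p (- u)) => _ [q /Ap[cq q00 qp] <-].
  have := cq 2^-1 u (- u); rewrite (_ : 1 - 2^-1 = 2^-1); last by lra.
  rewrite -scalerDr subrr scaler0 => /(_ _)/wrap[|H]; first by lra.
  by have := qp (- u); lra.
have mle q u : A q -> m u <= q u.
  by move=> Aq; apply: ge_inf; [exact: (lb u).2|exists q].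
split; last by move=> q Aq u; exact: mle.
split=> [t u v /andP[t0 t1]||u].
- have t1' : 0 <= 1 - t by rewrite subr_ge0.
  apply/ler_addgt0Pr => e e0.
  have /inf_adherent/(_ (lb u))[_ [q Aq <-] qu] := e0.
  have /inf_adherent/(_ (lb v))[_ [q' Aq' <-] qv] := e0.
  have [r Ar [ru rv]] : exists2 r, A r & r u < m u + e /\ r v < m v + e.
    have [qq'|q'q] := chA _ _ Aq Aq'.
      by exists q => //; split=> //; exact: le_lt_trans (qq' v) qv.
    by exists q' => //; split=> //; exact: le_lt_trans (q'q u) qu.
  have [cr _ _] := Ap _ Ar.
  rewrite (le_trans (mle _ _ Ar))//.
  apply: le_trans (cr t u v _) _; first by rewrite t0.
  have -> : t * m u + (1 - t) * m v + e = t * (m u + e) + (1 - t) * (m v + e).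
    by ring.
  by rewrite lerD// ler_wpM2l// ltW.
- apply: lb_le_inf; first exact: (lb 0).1.
  by move=> _ [q /Ap[_ ? _] <-].
- by rewrite (le_trans (mle _ u Aq0))//; have [_ _] := Ap _ Aq0.
Qed.

Lemma exists_minimal_convex p : convex_fun p -> 0 <= p 0 ->
  exists2 q, minimal_convex q & forall u, q u <= p u.
Proof.
move=> cp p0.
pose T := {q : V -> R | convex_minorant p q}.
pose ge (a b : T) := `[< forall u, sval b u <= sval a u >].
have [|||A chA|[m [cm m0 mp]] mmin] := @Zorn T ge.
- by move=> a; apply/asboolP.
- move=> a b c /asboolP ab /asboolP bc; apply/asboolP => u.
  exact: le_trans (bc u) (ab u).
- move=> [a pa] [b pb] /asboolP/= ab /asboolP/= ba; apply: eq_exist.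
  by apply/funext => u; apply/eqP; rewrite eq_le ab ba.
- have [[a Aa]|A0] := pselect (A !=set0); last first.
    have pp : convex_minorant p p by split.
    by exists (exist _ p pp) => a Aa; case: A0; exists a.
  have [| | |mp mle] := @chain_inf_minorant p [set sval a | a in A].
  + by exists (sval a), a.
  + by move=> _ [b _ <-]; exact: svalP b.
  + move=> _ _ [b Ab <-] [c Ac <-].
    by have [/asboolP|/asboolP] := chA _ _ Ab Ac; [right|left].
  + exists (exist _ _ mp) => b Ab; apply/asboolP => u /=.
    by apply: mle; exists b.
- exists m => //; split=> // q [cq q0 qm].
  have pq : convex_minorant p q by split=> // u; exact: le_trans (qm u) (mp u).
  have /mmin : ge (exist _ m (And3 cm m0 mp)) (exist _ q pq).
    exact/asboolP.
  by move=> /(congr1 sval)/= -> u.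
Qed.

(** The sandwich form of Hahn-Banach, with the functional extended from the zero
subspace; no continuity is involved. *)
Lemma hahn_banach_convex p : convex_fun p -> 0 <= p 0 ->
  exists2 f : V -> R^o, linear f & forall u, f u <= p u.
Proof.
move=> cp /(exists_minimal_convex p cp)[q /minimal_convex_linear lq qp].
by exists q.
Qed.

End hahn_banach.

(** * Duality between subgradients of a function and of its conjugate *)

Section conjugate.
Context {R : realType} {X : normedModType R}.
Implicit Types (x w : X) (y v : dual X).

Lemma dual_of_bounded (f : X -> R^o) (C K : R) : linear f -> 0 <= K ->
  (forall w, f w <= C + K * `|w|) -> f \in @clinear R X.
Proof.
move=> lf K0 fK; rewrite inE; split=> //.
pose g : {linear X -> R^o} := HB.pack f (GRing.isLinear.Build _ _ _ _ f lf).
apply: (bounded_linear_continuous (f := g)).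
apply/bounded_funP => r; exists (C + K * r) => w wr.
have bnd w' : `|w'| <= r -> f w' <= C + K * r.
  by move=> w'r; rewrite (le_trans (fK w'))// lerD2l ler_wpM2l.
rewrite ler_norml bnd// andbT lerNl -[- _]/(- (g w)) -linearN.
by apply: bnd; rewrite normrN.
Qed.

(** Think of [E] as an epigraph. The hypothesis says that the cone
[a < - K |w|] misses [E], and the conclusion is a nonvertical hyperplane through
the origin lying below [E]. It comes from Hahn-Banach applied to [p], the
inf-convolution of the function with epigraph [E] and of [K |.|], which is
finite and at most [a0 + K |u - w0|], whence the continuity of the functional. *)
Lemma dual_minorant_convex_set (E : set (X * R)) (K : R) :
  0 <= K -> E !=set0 ->
  (forall t w w' a a', 0 <= t <= 1 -> E (w, a) -> E (w', a') ->
    E (t *: w + (1 - t) *: w', t * a + (1 - t) * a')) ->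
  (forall w a, E (w, a) -> 0 <= a + K * `|w|) ->
  exists f : dual X, forall w a, E (w, a) -> f w <= a.
Proof.
move=> K0 [[w0 a0] Ewa0] cE posE.
pose S u := [set q.2 + K * `|u - q.1| | q in E].
pose p u := inf (S u).
have infS u : has_inf (S u).
  split; first by exists (a0 + K * `|u - w0|), (w0, a0).
  exists (- (K * `|u|)) => _ [[w a] /posE Ewa <-] /=.
  have : K * `|w| <= K * (`|u - w| + `|u|).
    by rewrite ler_wpM2l// distrC -[X in `|X| <= _](subrK u) ler_normD.
  by lra.
have pE u w a : E (w, a) -> p u <= a + K * `|u - w|.
  by move=> Ewa; apply: ge_inf; [exact: (infS u).2|exists (w, a)].
have cp : convex_fun p.
  move=> t u u' t01; have /andP[t0 t1] := t01.
  have t1' : 0 <= 1 - t by rewrite subr_ge0.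
  apply/ler_addgt0Pr => e e0.
  have /inf_adherent/(_ (infS u))[_ [[w a] Ewa <-] /= uw] := e0.
  have /inf_adherent/(_ (infS u'))[_ [[w' a'] Ewa' <-] /= uw'] := e0.
  apply: le_trans (pE _ _ _ (cE _ _ _ _ _ t01 Ewa Ewa')) _.
  have nE : `|t *: u + (1 - t) *: u' - (t *: w + (1 - t) *: w')| <=
      t * `|u - w| + (1 - t) * `|u' - w'|.
    rewrite opprD addrACA -!scalerBr (le_trans (ler_normD _ _))//.
    by rewrite !normrZ !ger0_norm.
  have -> : t * p u + (1 - t) * p u' + e = t * (p u + e) + (1 - t) * (p u' + e).
    by ring.
  have tu := ler_wpM2l t0 (ltW uw); have tu' := ler_wpM2l t1' (ltW uw').
  apply: le_trans (lerD tu tu'); have := ler_wpM2l K0 nE; lra.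
have p0 : 0 <= p 0.
  apply: lb_le_inf; first exact: (infS 0).1.
  by move=> _ [[w a] /posE Ewa <-] /=; rewrite sub0r normrN.
have [f lf fp] := hahn_banach_convex p cp p0.
have fd : f \in @clinear R X.
  apply: (@dual_of_bounded _ (a0 + K * `|w0|) K) => // u.
  apply: le_trans (fp u) _; apply: le_trans (pE u _ _ Ewa0) _.
  have := ler_wpM2l K0 (ler_normB u w0); lra.
exists (Dual fd) => w a Ewa; apply: le_trans (fp w) _.
by have := pE w _ _ Ewa; rewrite subrr normr0 mulr0 addr0.
Qed.

(** For a proper function the extended-real definition reduces to inequalities
between reals. *)
Lemma subdifferentialP (phi : X -> \bar R) x y : Gamma0 phi ->
  subdifferential phi x y <->
  exists2 r, phi x = r%:E & forall z s, phi z = s%:E -> y z - s <= y x - r.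
Proof.
move=> [phiNy [z0 phiz0] _ _]; split=> [[phix yz]|[r phix yz]].
  case phixE : (phi x) => [r| |]; last 2 first.
  - by rewrite phixE in phix.
  - by have := phiNy x; rewrite phixE.
  exists r => // z s phiz; have := yz z.
  by rewrite phiz phixE -EFinB lee_fin /pairing linearB/=; lra.
split=> [|z]; first by rewrite phix.
case phizE : (phi z) => [s| |].
- by rewrite phix -EFinB lee_fin /pairing linearB/=; have := yz _ _ phizE; lra.
- by rewrite phix addye// leey.
- by have := phiNy z; rewrite phizE.
Qed.

Lemma fenchel_conjugate_le (phi : X -> \bar R) y (c : R) : Gamma0 phi ->
  (fenchel_conjugate phi y <= c%:E)%E <->
  forall z s, phi z = s%:E -> y z - s <= c.
Proof.
move=> [phiNy _ _ _]; split=> [phic z s phiz|yc].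
  rewrite -lee_fin; apply: le_trans phic; apply: ereal_sup_ubound.
  by exists z => //; rewrite phiz.
apply: ge_ereal_sup => _ [z _ <-].
case phizE : (phi z) => [s| |]; last by have := phiNy z; rewrite phizE.
- by rewrite -EFinB lee_fin; exact: yc.
- by rewrite leNye.
Qed.

(** Right to left, [y] being a subgradient at [x] computes the conjugate at [y]
as [y x - phi x]. Left to right, let [c] be the conjugate at [y]; the claim is
[phi x <= y x - c]. Otherwise the affine minorant [y - c] of [phi] has a gap at
[x], and lower semicontinuity makes room for another affine minorant, of slope
[v] and strictly above [y - c] at [x]. That makes the conjugate at [v] smaller
than [c + (v - y) x], which contradicts [x] being a subgradient at [y]. *)
Lemma fenchel_young (phi : X -> \bar R) x y : Gamma0 phi ->
  subdifferential_dual (fenchel_conjugate phi) y x <->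
  subdifferential phi x y.
Proof.
move=> Gphi; have [phiNy [z0 phiz0] cphi lphi] := Gphi.
split; last first.
  move=> /(subdifferentialP _ _ _ Gphi)[r phix yz].
  have geE v : ((v x - r)%:E <= fenchel_conjugate phi v)%E.
    by apply: ereal_sup_ubound; exists x => //; rewrite phix.
  have cyE : fenchel_conjugate phi y = (y x - r)%:E.
    by apply/eqP; rewrite eq_le geE andbT; exact/fenchel_conjugate_le.
  split=> [|v]; rewrite cyE// leeBrDr// -EFinD.
  have -> : pairing x (v - y) + (y x - r) = v x - r; last exact: geE.
  by rewrite addrA; congr (_ - _); exact: subrK.
move=> [cy xv].
have [c cE] : exists c, fenchel_conjugate phi y = c%:E.
  case cE : (fenchel_conjugate phi y) => [c| |]; first by exists c.
  - by rewrite cE in cy.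
  - have : (fenchel_conjugate phi y <= (y z0 - fine (phi z0) - 1)%:E)%E.
      by rewrite cE leNye.
    move=> /(fenchel_conjugate_le _ _ _ Gphi)/(_ z0 (fine (phi z0))).
    by rewrite fineK// => /(_ erefl); lra.
have yc : forall z s, phi z = s%:E -> y z - s <= c.
  by apply/(fenchel_conjugate_le _ _ _ Gphi); rewrite cE.
suff phixle : (phi x <= (y x - c)%:E)%E.
  have [r phix] : exists r, phi x = r%:E.
    case phixE : (phi x) => [r| |]; first by exists r.
    - by rewrite phixE in phixle.
    - by have := phiNy x; rewrite phixE.
  apply/(subdifferentialP _ _ _ Gphi); exists r => // z s /yc yzs.
  by move: phixle; rewrite phix lee_fin; lra.
rewrite leNgt; apply/negP => gap.
have [r r0 phixr] : exists2 r : R, 0 < r & ((y x - c + 2 * r)%:E < phi x)%E.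
  case phixE : (phi x) gap => [s| |] gap; last by [].
  - rewrite lte_fin in gap.
    by exists ((s - (y x - c)) / 4); [|rewrite lte_fin]; lra.
  - by exists 1; rewrite ?ltry.
have [V xV Vphi] := lphi _ _ phixr.
have : nbhs x (V `&` [set z | `|y x - y z| < r]).
  apply: filterI => //.
  have /cvgrPdist_lt := @dual_continuous _ _ y x; exact.
move=> /nbhs_normP[d /= d0 dV].
(* [E] is the epigraph of [phi] seen from [x], after subtraction of the affine
   minorant raised by [r]. It lies above 0 within distance [d] of [x] by lower
   semicontinuity, and above [- r] everywhere, hence above the cone of slope
   [r / d]. *)
pose E := [set q : X * R | (phi (x + q.1)%R <=
  (q.2 + r + (y x - c) + y q.1)%:E)%E].
have [||t w w' a a' t01||f fE] := @dual_minorant_convex_set E (r / d).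
- by rewrite divr_ge0// ltW.
- exists (z0 - x, fine (phi z0) - r - (y x - c) - y (z0 - x)).
  by rewrite /E /= subrKC -[X in (X <= _)%E]fineK// lee_fin; lra.
- rewrite /E /= => Ewa Ewa'; have /andP[t0 t1] := t01.
  have -> : x + (t *: w + (1 - t) *: w') = t *: (x + w) + (1 - t) *: (x + w').
    by rewrite !scalerDr addrACA -scalerDl subrKC scale1r.
  apply: le_trans (cphi _ _ _ t01) _.
  have t1' : 0 <= 1 - t by rewrite subr_ge0.
  apply: le_trans (leeD (lee_wpmul2l _ Ewa) (lee_wpmul2l _ Ewa')) _;
    rewrite ?lee_fin//.
  have -> : y (t *: w + (1 - t) *: w') = t * y w + (1 - t) * y w'.
    by rewrite linearD !linearZ.
  by lra.
- move=> w a; rewrite /E /= => Ewa.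
  have [wd|dw] := ltP `|w| d.
    have [] : (V `&` [set z | `|y x - y z| < r]) (x + w).
      by apply: dV; rewrite /ball_ /= opprD addNKr normrN.
    move=> /Vphi /lt_le_trans/(_ Ewa); rewrite lte_fin /= linearD opprD addNKr.
    rewrite normrN ltr_norml => ? /andP[? ?].
    have : 0 <= r / d * `|w| by rewrite mulr_ge0// divr_ge0// ltW.
    by lra.
  have rw : r <= r / d * `|w|.
    by rewrite -mulrA ler_pMr// mulrC ler_pdivlMr// mul1r.
  have [s phis] : exists s, phi (x + w) = s%:E.
    case phiE : (phi (x + w)) Ewa => [s| |]// Ewa; first by exists s.
    by have := phiNy (x + w); rewrite phiE.
  by move: Ewa; have := yc _ _ phis; rewrite phis lee_fin linearD; lra.
have [v vE] : exists v : dual X, forall u, v u = y u + f u by exists (y + f).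
have : (fenchel_conjugate phi v <= (v x - (y x - c) - r)%:E)%E.
  apply/(fenchel_conjugate_le _ _ _ Gphi) => z s phiz.
  have := fE (z - x) (s - r - (y x - c) - y (z - x)).
  rewrite /E /= subrKC phiz lee_fin => /(_ _)/wrap[|]; first by lra.
  by rewrite !vE !linearB/=; lra.
have := xv v; rewrite cE leeBrDr// => /le_trans/[apply].
rewrite -EFinD lee_fin /pairing.
have -> : (v - y) x = v x - y x by [].
by rewrite vE; lra.
Qed.

End conjugate.

(** * Closedness of the enlarged subdifferential graph *)

Section enlargement.
Context {R : realType} {X : normedModType R}.
Implicit Types (x z : X) (y u v : dual X).

Lemma ultra_bounded_cvg (T : Type) (G : set_system T) (h : T -> R) (C : R) :
  UltraFilter G -> (\forall q \near G, `|h q| <= C) ->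
  exists l : R, h q @[q --> G] --> l.
Proof.
move=> GU hC.
have [] := @segment_compact R (- C) C (h q @[q --> G]) _ _.
  by near=> q; rewrite /= in_itv/= -ler_norml; near: q.
move=> l [_ hl]; exists l => B lB.
have [//|GnB] := in_ultra_setVsetC (h @^-1` B) GU.
by have [a []] := hl (~` B) B GnB lB.
Unshelve. all: by end_near. Qed.

Lemma dual_norm_leP u (M : R) : 0 <= M ->
  `|u| <= M <-> forall z, `|u z| <= M * `|z|.
Proof.
move=> M0; split=> [uM z|uM].
  by rewrite (le_trans (dual_norm_opP u z))// ler_wpM2r.
apply: ge_sup; first by exists `|u 0|, 0 => //=; rewrite normr0.
move=> _ [z z1 <-]; apply: le_trans (uM z) _.
by rewrite -[leRHS]mulr1 ler_wpM2l.
Qed.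

(** The sum of the subdifferential graph and of a vertical ball. Stating it for
all radii makes the graph itself the case of radius 0. *)
Definition enlargement (phi : X -> \bar R) (eps : R) : set (X * dual X) :=
  [set p | exists2 u, subdifferential phi p.1 u & `|p.2 - u| <= eps].

(** Weak-* compactness enters through [ultra_bounded_cvg], one evaluation at a
time: the ultrafilter makes all pointwise limits exist simultaneously. *)
Lemma enlargement_closed (phi : X -> \bar R) (eps : R) :
  Gamma0 phi -> 0 <= eps -> closed (enlargement phi eps).
Proof.
move=> Gphi eps0 [x y] clxy.
have [phiNy [z0 phiz0] _ lphi] := Gphi.
have [G [GU nG]] := ultraFilterLemma (within_nbhs_proper clxy).
have GN : G (enlargement phi eps) := nG _ (withinT _ _).
have Gxy : nbhs (x, y) `<=` G by move=> B xyB; apply: nG; apply: (@filterS _ _ _ _ _ _ xyB).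
have /choice[u uP] : forall q, exists v, enlargement phi eps q ->
    subdifferential phi q.1 v /\ `|q.2 - v| <= eps.
  move=> q; have [[v ? ?]|nq] := pselect (enlargement phi eps q).
    by exists v.
  by exists 0.
have Gx : q.1 @[q --> G] --> x.
  by move=> B xB; apply: Gxy; exact: (@cvg_fst _ _ (nbhs x) (nbhs y)).
have Gy : q.2 @[q --> G] --> y.
  by move=> B yB; apply: Gxy; exact: (@cvg_snd _ _ (nbhs x) (nbhs y)).
have uy (e : R) : 0 < e -> \forall q \near G, `|u q - y| <= eps + e.
  move=> e0; near=> q.
  rewrite -[u q](subrK q.2) -addrA (le_trans (ler_normD _ _))// lerD//.
    by rewrite distrC; have [] := uP q; first by near: q; exact: GN.
  by rewrite distrC ltW//; near: q; move/cvgrPdist_lt : Gy; exact.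
have [C C0 uC] : exists2 C : R, 0 < C & \forall q \near G, `|u q| <= C.
  exists (eps + 1 + `|y|); first by rewrite ltr_pwDl// ltr_wpDl.
  near=> q; rewrite -[u q](subrK y) (le_trans (ler_normD _ _))// lerD2r.
  by near: q; exact: uy.
have uCz z : \forall q \near G, `|u q z| <= C * `|z|.
  near=> q; apply: (dual_norm_leP _ _ (ltW C0)).1.
  by near: q.
have /choice[g ug] z := ultra_bounded_cvg _ _ _ _ GU (uCz z).
have lg : linear (g : X -> R^o).
  move=> a z w; apply: (cvg_unique (@Rhausdorff R) (ug (a *: z + w))).
  rewrite (_ : (fun q => _) = (fun q => a * u q z + u q w)); last first.
    by apply/funext => q; rewrite linearD linearZ.
  by apply: cvgD => //; exact: cvgMr.
have gd : (g : X -> R^o) \in @clinear R X.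
  apply: (@dual_of_bounded _ _ _ 0 C) => //; first exact: ltW.
  move=> z; rewrite add0r; apply: (cvgr_to_le (ug z)).
  by apply: filterS (uCz z) => q; exact: le_trans (ler_norm _).
exists (Dual gd) => /=; last first.
  apply/ler_addgt0Pr => e e0; rewrite distrC.
  apply/dual_norm_leP => [|z]; first by rewrite addr_ge0// ltW.
  have ugy : `|u q z - y z| @[q --> G] --> `|g z - y z|.
    by apply: cvg_norm; apply: cvgB => //; exact: cvg_cst.
  apply: (cvgr_to_le ugy); near=> q.
  have /dual_norm_leP : `|u q - y| <= eps + e by near: q; exact: uy.
  by apply; rewrite addr_ge0// ltW.
(* [phi x] may be infinite at this stage, so the subgradient inequality at the
   limit is first stated for the reals [a] below [phi x]. *)
have key z (s a : R) : phi z = s%:E -> (a%:E < phi x)%E -> g z - g x <= s - a.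
  move=> phiz /lphi[V xV Va]; apply/ler_addgt0Pr => e e0.
  have ugzx : u q z - u q x @[q --> G] --> g z - g x by exact: cvgB.
  apply: (cvgr_to_le ugzx); near=> q.
  have /uP[/(subdifferentialP _ _ _ Gphi)[r phiq uq] _] : enlargement phi eps q.
    by near: q; exact: GN.
  have := uq _ _ phiz.
  have : (a%:E < phi q.1)%E by apply: Va; near: q; exact: Gx.
  rewrite phiq lte_fin.
  have : u q (q.1 - x) <= e.
    apply: le_trans (ler_norm _) _; apply: le_trans (dual_norm_opP _ _) _.
    apply: (@le_trans _ _ (C * `|q.1 - x|)).
      by rewrite ler_wpM2r//; near: q.
    rewrite -ler_pdivlMl// distrC ltW//; near: q.
    by move/cvgrPdist_lt : Gx; apply; rewrite mulr_gt0// invr_gt0.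
  by rewrite linearB/=; lra.
have [r phix] : exists r, phi x = r%:E.
  case phixE : (phi x) => [r| |]; first by exists r.
  (* An infinite [phi x] would allow [a] to be arbitrarily large. *)
  - have := key z0 (fine (phi z0)) (fine (phi z0) - (g z0 - g x) + 1).
    by rewrite phixE fineK// ltry => /(_ erefl isT); lra.
  - by have := phiNy x; rewrite phixE.
apply/(subdifferentialP _ _ _ Gphi); exists r => // z s phiz /=.
suff : g z - g x <= s - r by lra.
apply/ler_addgt0Pr => e e0.
have := key z s (r - e) phiz; rewrite phix lte_fin gtrBl => /(_ e0); lra.
Unshelve. all: by end_near. Qed.

End enlargement.

(** * Convexity of sections *)

Section convex_sections.
Context {R : realType}.

Lemma convex_setP (V : lmodType R) (A : set V) :
  convex_set (A : set (convex_lmodType V)) <->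
  forall (t : R) u v, 0 <= t <= 1 -> A u -> A v -> A (t *: u + (1 - t) *: v).
Proof.
split=> [cA t u v /andP[t0 t1] Au Av|cA u v l].
  by have := cA u v (Itv01 t0 t1); rewrite !inE; exact.
by rewrite !inE => Au Av; apply: cA => //; rewrite ge0 le1.
Qed.

Lemma convex_set_le_norm (V : normedModType R) (e : R) :
  convex_set ([set v : V | `|v| <= e] : set (convex_lmodType V)).
Proof.
apply/convex_setP => t u v /andP[t0 t1] /= ue ve.
have t1' : 0 <= 1 - t by rewrite subr_ge0.
rewrite (le_trans (ler_normD _ _))// !normrZ !ger0_norm//.
have := ler_wpM2l t0 ue; have := ler_wpM2l t1' ve; lra.
Qed.

Lemma closed_le_norm (V : normedModType R) (e : R) :
  closed [set v : V | `|v| <= e].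
Proof.
apply: (@preimage_closed _ _ (fun v : V => `|v|) [set r | r <= e]).
  by move=> v _; exact: norm_continuous.
exact: closed_le.
Qed.

Context {X : normedModType R}.

Lemma BB_graph_closed (M : set (X * dual X)) : closed M ->
  (forall x, convex_set (xsection M x : set (convex_lmodType (dual X)))) ->
  (forall y, convex_set (ysection M y : set (convex_lmodType X))) ->
  BB_graph M.
Proof.
move=> clM cx cy; split=> [x|y]; split=> //.
- have -> : xsection M x = pair x @^-1` M.
    by apply/seteqP; split=> y /xsectionP.
  apply: preimage_closed => // y _.
  exact: (@cvg_pair _ _ _ (nbhs y) (nbhs x) (nbhs y) _ _ _ _ _
    (cvg_cst x) cvg_id).
- have -> : ysection M y = (fun x => (x, y)) @^-1` M.
    by apply/seteqP; split=> x /ysectionP.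
  apply: preimage_closed => // x _.
  exact: (@cvg_pair _ _ _ (nbhs x) (nbhs x) (nbhs y) _ _ _ _ _
    cvg_id (cvg_cst y)).
Qed.

Lemma BB_graph_setX (C : set X) (D : set (dual X)) :
  convex_set (C : set (convex_lmodType X)) -> closed C ->
  convex_set (D : set (convex_lmodType (dual X))) -> closed D ->
  BB_graph (C `*` D).
Proof.
move=> cC clC cD clD.
have c0 (V : lmodType R) : convex_set (set0 : set (convex_lmodType V)).
  by apply/convex_setP.
split=> [x|y].
- have [xC|xC] := boolP (x \in C); first by rewrite in_xsectionX.
  by rewrite notin_xsectionX//; split=> //; exact: closed0.
- have [yD|yD] := boolP (y \in D); first by rewrite in_ysectionX.
  by rewrite notin_ysectionX//; split=> //; exact: closed0.
Qed.

(** Closedness of the subdifferential graph is thus a case of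
[enlargement_closed]. *)
Lemma enlargement0 (phi : X -> \bar R) :
  enlargement phi 0 = subdifferential_graph phi.
Proof.
apply/seteqP; split=> [[x y] [u xu] /=|[x y] xy].
  by rewrite normr_le0 subr_eq0 => /eqP ->.
by exists y => //=; rewrite subrr normr0.
Qed.

Lemma Minkowski_sum_ball (phi : X -> \bar R) (eps : R) :
  Minkowski_sum (subdifferential_graph phi)
    ([set (0 : X)] `*` [set y : dual X | `|y| <= eps]) = enlargement phi eps.
Proof.
apply/seteqP; split=> [p [[x u] xu [[x' v] [/= -> ve] <-]]|[x y] [u xu yu]].
  by exists u; [rewrite /= addr0|rewrite /= addrC addKr].
exists (x, u) => //; exists (0, y - u) => //=.
by congr pair; [exact: addr0|exact: subrKC].
Qed.

(** The only place where the conjugate enters the theorem: membership in a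
horizontal section is transposed by [fenchel_young]. *)
Lemma ysection_enlargement (phi : X -> \bar R) (eps : R) y : Gamma0 phi ->
  ysection (enlargement phi eps) y =
  \bigcup_(v in [set v : dual X | `|v - y| <= eps])
    subdifferential_dual (fenchel_conjugate phi) v.
Proof.
move=> Gphi; apply/seteqP; split=> x.
- move=> /ysectionP[u xu yu]; exists u; first by rewrite /= distrC.
  exact/(fenchel_young _ _ _ Gphi).
- move=> [v /= vy /(fenchel_young _ _ _ Gphi) xv].
  by apply/ysectionP; exists v => //=; rewrite distrC.
Qed.

Lemma convex_xsection_enlargement (phi : X -> \bar R) (eps : R) x :
  Gamma0 phi ->
  convex_set (xsection (enlargement phi eps) x
    : set (convex_lmodType (dual X))).
Proof.
move=> Gphi; apply/convex_setP => t y y' t01.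
move=> /xsectionP[u /(subdifferentialP _ _ _ Gphi)[r phix xu] /= yu].
move=> /xsectionP[u' /(subdifferentialP _ _ _ Gphi)[r' phix' xu'] /= yu'].
apply/xsectionP; exists (t *: u + (1 - t) *: u').
  apply/(subdifferentialP _ _ _ Gphi); exists r => // z s phiz.
  have /andP[t0 t1] := t01; have t1' : 0 <= 1 - t by rewrite subr_ge0.
  have rr' : r = r' by apply: EFin_inj; rewrite -phix.
  have uE w : (t *: u + (1 - t) *: u') w = t * u w + (1 - t) * u' w by [].
  have := ler_wpM2l t0 (xu _ _ phiz); have := ler_wpM2l t1' (xu' _ _ phiz).
  by rewrite !uE -rr'; lra.
rewrite /= opprD addrACA -!scalerBr.
by have /convex_setP := @convex_set_le_norm (dual X) eps; apply.
Qed.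

(** The points at which [y] is a subgradient minimize [phi - y], and minimizers
of a convex function form a convex set. *)
Lemma convex_ysection_subdifferential (phi : X -> \bar R) y : Gamma0 phi ->
  convex_set (ysection (subdifferential_graph phi) y
    : set (convex_lmodType X)).
Proof.
move=> Gphi; have [phiNy _ cphi _] := Gphi.
apply/convex_setP => t x x' t01.
move=> /ysectionP/(subdifferentialP _ _ _ Gphi)[r phix xy].
move=> /ysectionP/(subdifferentialP _ _ _ Gphi)[r' phix' xy'].
apply/ysectionP/(subdifferentialP _ _ _ Gphi) => /=.
have /andP[t0 t1] := t01; have t1' : 0 <= 1 - t by rewrite subr_ge0.
have := cphi _ x x' t01; rewrite phix phix' -!EFinM -EFinD.
case phiE : (phi _) => [m| |]; last 2 first.
- by rewrite leye_eq.
- by have := phiNy (t *: x + (1 - t) *: x'); rewrite phiE.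
rewrite lee_fin => mle; exists m => // z s phiz.
have -> : y (t *: x + (1 - t) *: x') = t * y x + (1 - t) * y x'.
  by rewrite linearD !linearZ.
have := ler_wpM2l t0 (xy _ _ phiz); have := ler_wpM2l t1' (xy' _ _ phiz); lra.
Qed.

End convex_sections.

(** * Blurring by a vertical ball *)

Theorem proposition6p1 (R : realType) (X : completeNormedModType R)
    (hX : reflexive_space X) (eps : R) (heps : 0 < eps)
    (phi : X -> \bar R) (hphi : Gamma0 phi) :
  admits_blurring (subdifferential_graph phi)
    ([set (0 : X)] `*` [set y : dual X | `|y| <= eps]) <->
  (forall y : dual X,
    convex_set
      ((\bigcup_(ybar in [set ybar : dual X | `|ybar - y| <= eps])
          subdifferential_dual (fenchel_conjugate phi) ybar)
        : set (convex_lmodType X))).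
Proof.
have eps0 := ltW heps.
rewrite /admits_blurring Minkowski_sum_ball; split.
  by move=> [_ _ _ [_ cy]] y; rewrite -ysection_enlargement//; exact: (cy y).1.
move=> cy; split.
- rewrite -enlargement0; apply: BB_graph_closed.
  + exact: enlargement_closed.
  + by move=> x; exact: convex_xsection_enlargement.
  + by move=> y; rewrite enlargement0; exact: convex_ysection_subdifferential.
(* [{0}] is the closed ball of radius 0. *)
- have set1E : [set (0 : X)] = [set x | `|x| <= 0].
    apply/seteqP; split=> x /=; first by move->; rewrite normr0.
    by rewrite normr_le0 => /eqP.
  rewrite set1E; apply: BB_graph_setX; try exact: convex_set_le_norm;
    exact: closed_le_norm.
- by split=> //=; rewrite normr0.
- apply: BB_graph_closed.
  + exact: enlargement_closed.
  + by move=> x; exact: convex_xsection_enlargement.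
  + by move=> y; rewrite ysection_enlargement.
Qed.
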